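(* Let $N \ge 2$ be an integer. If $M$ is an integer with $M \geq R_{N-1}-2N+1$, then for all positive integers $m \geq M$ and all integers $n$ with $2 \leq n \leq N$, $$\mathfrak{pr}(P_m+P_n) = \begin{cases} m+2n-2 & \text{if } m \text{ is odd},\\ m+2n-1 & \text{if } m \text{ is even}.\end{cases}$$
   Context: All graphs are finite and simple. A coprime labeling of a graph $G$ is an injection $f\colon V(G)\to\{1,2,\dots,k\}$, for some integer $k\ge |V(G)|$, such that $\gcd(f(u),f(v))=1$ whenever $(u,v)\in E(G)$. The minimum coprime number $\mathfrak{pr}(G)$ is the least $k$ for which such a labeling exists. $P_n$ is the path on $n$ vertices. The join $G+H$ of two disjoint graphs is the union $G\cup H$ together with all edges between a vertex of $G$ and a vertex of $H$. For $k\ge 1$, the $k$-th Ramanujan prime $R_k$ is the least integer such that $\pi(x)-\pi(x/2)\ge k$ for all $x\ge R_k$, where $\pi(x)$ is the number of primes less than or equal to $x$. *)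

(* Defs.v *)
From HB Require Import structures.
From mathcomp Require Import all_boot all_order all_algebra.
From mathcomp Require Import boolp reals.
Set Implicit Arguments.
Unset Strict Implicit.
Unset Printing Implicit Defensive.
Import Order.TTheory GRing.Theory Num.Theory.

Record sgraph := SGraph {
  vertex :> finType;
  edge : rel vertex;
  edge_sym : symmetric edge;
  edge_irrefl : irreflexive edge }.

Definition path_edge (n : nat) : rel 'I_n :=
  fun i j => (i.+1 == j :> nat) || (j.+1 == i :> nat).

Lemma path_edge_sym n : symmetric (@path_edge n).
Proof. by move=> i j; rewrite /path_edge orbC. Qed.

Lemma path_edge_irrefl n : irreflexive (@path_edge n).
Proof. by move=> i; rewrite /path_edge orbb gtn_eqF. Qed.

Definition path_graph (n : nat) : sgraph :=
  SGraph (@path_edge_sym n) (@path_edge_irrefl n).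

Definition join_edge (G H : sgraph) : rel (G + H)%type :=
  fun u v => match u, v with
  | inl x, inl y => edge x y
  | inr x, inr y => edge x y
  | _, _ => true
  end.

Lemma join_edge_sym G H : symmetric (@join_edge G H).
Proof. by move=> [x|x] [y|y] //=; exact: edge_sym. Qed.

Lemma join_edge_irrefl G H : irreflexive (@join_edge G H).
Proof. by move=> [x|x] /=; exact: edge_irrefl. Qed.

Definition join_graph (G H : sgraph) : sgraph :=
  SGraph (@join_edge_sym G H) (@join_edge_irrefl G H).

Definition coprime_labeling (G : sgraph) (k : nat) (f : G -> nat) : Prop :=
  [/\ injective f,
      forall v, 1 <= f v <= k
    & forall u v, edge u v -> gcdn (f u) (f v) = 1].

Definition has_coprime_labeling (G : sgraph) (k : nat) : Prop :=
  #|G| <= k /\ exists f : G -> nat, coprime_labeling k f.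

(* Labeling the vertices with distinct primes is always possible. *)
Lemma ex_coprime_labeling (G : sgraph) :
  exists k, `[< has_coprime_labeling G k >].
Proof.
pose g m := s2val (prime_above m).
have g_gt m : m < g m by rewrite /g; case: prime_above.
have g_prime m : prime (g m) by rewrite /g; case: prime_above.
pose p i := iter i.+1 g 0.
have p_incr : {homo p : i j / i < j}
    by apply: homo_ltn => [y x z|i]; [exact: ltn_trans|exact: g_gt].
have p_inj : injective p.
  by move=> i j eq_p; case: (ltngtP i j) => // /p_incr; rewrite eq_p ltnn.
have p_prime i : prime (p i) by exact: g_prime.
pose f (v : G) := p (enum_rank v).
have f_prime v : prime (f v) by exact: p_prime.
have f_inj : injective f by move=> u v /p_inj /val_inj /enum_rank_inj.
exists (#|G| + \max_(v : G) f v); apply/asboolP; split; first exact: leq_addr.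
exists f; split=> // [v|u v uv].
  apply/andP; split; first exact: prime_gt0 (f_prime v).
  by apply: leq_trans (leq_addl _ _); exact: (leq_bigmax v).
apply/eqP; change (coprime (f u) (f v)).
rewrite (prime_coprime _ (f_prime u)) (dvdn_prime2 (f_prime u) (f_prime v)).
apply/eqP => /f_inj eq_uv.
by move: uv; rewrite eq_uv edge_irrefl.
Qed.

Definition min_coprime_number (G : sgraph) : nat :=
  ex_minn (ex_coprime_labeling G).

Local Open Scope ring_scope.

(* For negative x, Num.truncn x is 0, so the count is 0. *)
Definition prime_pi (R : realType) (x : R) : nat :=
  count prime (iota 0 (Num.truncn x).+1).

(* prime_pi is nondecreasing, so the natural-number subtraction below never
   truncates. *)
Definition ramanujan_bound (R : realType) (k : nat) (r : int) : Prop :=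
  forall x : R, r%:~R <= x -> (k <= prime_pi x - prime_pi (x / 2))%N.

(* r is the k-th Ramanujan prime, for k >= 1. *)
Definition is_ramanujan_prime (R : realType) (k : nat) (r : int) : Prop :=
  ramanujan_bound R k r /\
  (forall s : int, ramanujan_bound R k s -> r <= s).

(* Main.v *)
Require Import Defs.
From mathcomp Require Import all_boot all_order all_algebra.
From mathcomp Require Import zify lra.
From mathcomp Require Import boolp reals.

(** It is enough to treat odd [m], with k = m + 2n - 2, which is odd: for even
    [m] one deletes an end of the longer path from a labeling for [m + 1], and
    the lower bound grows accordingly.

    Lower bound ([coprime_labeling_lower]). Two even labels are never adjacent,
    so, the graph being a join, all even labels lie on a single one of the two
    paths, where they form an independent set. There are thus at most
    [uphalf m] of them as soon as [uphalf n <= uphalf m], and all other labels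
    are distinct odd numbers up to k.

    Upper bound ([coprime_labeling_of_primes]). Label P_n with 1 and a set S of
    n - 1 odd primes p such that k/2 < p <= k. Such a prime divides no other
    number up to k, so it only remains to order m of the numbers left. Let p be
    the largest element of S. The odd numbers below p outside S, in increasing
    order, leave gaps 2, 4 or 6, because three consecutive odd numbers cannot
    all be primes of S; in each gap some even number is coprime to both ends
    ([even_between]). This gives a walk 2, 3, e, o, e', o', and so on, which
    can be closed by the even successor of its last odd number. In front of its
    initial 2, which is coprime to the odd number k, one puts p+1, ..., k. All
    odd numbers except 1 and the elements of S are used, and there is one more
    even number than odd ones, so that the length is k - 2(n - 1) = m.

    Counting primes. The Ramanujan bound says that the upper half of [0, a]
    contains at least N - 1 primes for every natural a >= r, and
    m + 2N - 1 >= r. If this number is even, stepping down to its odd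
    predecessor loses no prime; from m + 2N - 2 one descends to m + 2n - 2, and
    each step by 2 loses at most one prime ([upper_primes_descend]). Finally,
    as the upper half of [0, a] has few primes, r is large with respect to N
    ([size_upper_primes_small]), which makes m at least N when N > 2 and so
    gives the comparison of m and n that the lower bound requires. *)

(** * Lower bound *)

Lemma card_le_bound (T : finType) (A : {pred T}) (g : T -> nat) b :
  {in A &, injective g} -> (forall x, x \in A -> g x < b) -> #|A| <= b.
Proof.
move=> g_inj g_lt; rewrite cardE -(size_map g) -(size_iota 0 b).
apply: uniq_leq_size => [|y /mapP[x]].
  rewrite map_inj_in_uniq ?enum_uniq // => x y.
  by rewrite !mem_enum; exact: g_inj.
by rewrite mem_enum mem_iota => /g_lt lt_x ->.
Qed.

(** Both labels would be divisible by 2. *)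
Lemma even_labels_not_adjacent (G : sgraph) k (f : G -> nat) (u v : G) :
  coprime_labeling k f -> ~~ odd (f u) -> ~~ odd (f v) -> ~~ edge u v.
Proof.
move=> [_ _ fcop]; rewrite -!dvdn2 => u2 v2; apply/negP => /fcop E.
have : 2 %| gcdn (f u) (f v) by rewrite dvdn_gcd u2.
by rewrite E.
Qed.

(** Halving sends two distinct vertices of a path to the same value only when
    they are 2j and 2j + 1, which are adjacent; hence an independent set of
    [path_graph n] injects into [uphalf n] values. *)
Lemma path_half_inj (n : nat) (i j : path_graph n) :
  ~~ edge i j -> i./2 = j./2 -> i = j.
Proof. by rewrite /= /path_edge => nij E; apply: ord_inj; lia. Qed.

(** Odd labels are counted by [uphalf k], even ones by [uphalf m]; the sum of
    the two bounds is at least [m + n]. *)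
Lemma coprime_labeling_lower m n k :
  uphalf n <= uphalf m ->
  has_coprime_labeling (join_graph (path_graph m) (path_graph n)) k ->
  m./2.*2 + n.*2 <= k.+1.
Proof.
set G := join_graph _ _ => le_nm [_ [f fL]].
have [f_inj f_itv _] := fL.
pose ev := [pred v : G | ~~ odd (f v)].
have card_odd : #|[predC ev]| <= uphalf k.
  apply: (@card_le_bound _ _ (fun v => (f v)./2)) => [u v|v].
    by rewrite !inE /= !negbK => u_odd v_odd E; apply: f_inj; lia.
  by rewrite !inE /= negbK => v_odd; have := f_itv v; lia.
have nadj (u v : G) : u \in ev -> v \in ev -> ~~ edge u v.
  by rewrite !inE; exact: even_labels_not_adjacent fL.
have card_even : #|ev| <= uphalf m.
  (* Even labels cannot occur on both sides of the join, so forgetting the side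
     keeps this map injective on them. *)
  pose g (v : G) := match v with inl i => i./2 | inr j => j./2 end.
  apply: (@card_le_bound _ _ g) => [[i|i] [j|j] iev jev /= E|[i|j] _] /=.
  - by have := nadj _ _ iev jev => /path_half_inj ->.
  - by have := nadj _ _ iev jev.
  - by have := nadj _ _ iev jev.
  - by have := nadj _ _ iev jev => /path_half_inj ->.
  - by have := ltn_ord i; lia.
  - by have := ltn_ord j; lia.
have := cardC ev; rewrite card_sum !card_ord => E.
have : m + n <= uphalf m + uphalf k by rewrite -E leq_add.
lia.
Qed.

(** * Labelings given by sequences *)

(** Reading the labels along each path turns adjacency into [sorted coprime],
    which suits inductive constructions better than functions on vertices. *)
Lemma has_coprime_labeling_of_seq m n k (s t : seq nat) :
  size s = m -> size t = n -> uniq (s ++ t) ->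
  {in s ++ t, forall x, 0 < x <= k} ->
  sorted coprime s -> sorted coprime t -> allrel coprime s t ->
  has_coprime_labeling (join_graph (path_graph m) (path_graph n)) k.
Proof.
move=> sz_s sz_t st_uniq st_itv s_cop t_cop /allrelP st_cop.
have path_cop l (q : seq nat) (i j : 'I_l) : size q = l -> sorted coprime q ->
    path_edge i j -> coprime (nth 0 q i) (nth 0 q j).
  move=> sz_q /(sortedP 0) q_cop /orP[] /eqP E; rewrite -E ?[coprime _.+1 _]coprime_sym.
    by apply: q_cop; rewrite E sz_q.
  by rewrite coprime_sym; apply: q_cop; rewrite E sz_q.
pose f (v : join_graph (path_graph m) (path_graph n)) :=
  match v with inl i => nth 0 s i | inr j => nth 0 t j end.
have f_mem v : f v \in s ++ t.
  rewrite mem_cat; case: v => [i|j] /=.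
    by rewrite mem_nth // sz_s.
  by rewrite orbC mem_nth // sz_t.
(* Position of a vertex in the concatenated list of labels. *)
pose h (v : join_graph (path_graph m) (path_graph n)) : nat :=
  match v with inl i => i | inr j => m + j end.
have fE v : f v = nth 0 (s ++ t) (h v).
  rewrite nth_cat sz_s; case: v => [i|j] /=; first by rewrite ltn_ord.
  by rewrite ifN ?addKn // -leqNgt leq_addr.
have h_lt v : h v < size (s ++ t).
  rewrite size_cat sz_s sz_t.
  by case: v => [i|j] /=; [have := ltn_ord i | have := ltn_ord j]; lia.
split.
  have := uniq_leq_size st_uniq (s2 := iota 1 k).
  rewrite size_cat sz_s sz_t size_iota card_sum !card_ord; apply => x /st_itv.
  by rewrite mem_iota add1n ltnS.
exists f; split => [u v||u v].
- rewrite !fE => /eqP; rewrite nth_uniq // => /eqP.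
  case: u v => [i|i] [j|j] /= E.
  + by congr inl; apply: ord_inj.
  + by have := ltn_ord i; lia.
  + by have := ltn_ord j; lia.
  + by congr inr; apply: ord_inj; lia.
- by move=> v; exact: st_itv.
- case: u v => [i|i] [j|j] /= E; apply/eqP.
  + exact: path_cop E.
  + by apply: st_cop; rewrite mem_nth ?sz_s ?sz_t.
  + by rewrite -/(coprime _ _) coprime_sym; apply: st_cop; rewrite mem_nth ?sz_s ?sz_t.
  + exact: path_cop E.
Qed.

(** * Walks avoiding a sparse set of odd numbers *)

(** Asking walks to increase makes the distinctness of their entries
    automatic. *)
Definition coprime_lt : rel nat := fun x y => (x < y) && coprime x y.

(** The candidates are o + 1 and o + g - 1. The first one is adjacent to o and
    at distance g - 1, which is 1, 3 or 5, from the other end. If it fails, the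
    prime g - 1 divides o + 1, hence not o, and the second one succeeds. The
    last clause holds since for o = 1 the first candidate, 2, works; it makes every walk from 1
    continue with 2. *)
Lemma even_between o g :
  odd o -> g \in [:: 2; 4; 6] ->
  exists e, [/\ o < e < o + g, ~~ odd e, coprime o e, coprime e (o + g)
              & o = 1 -> e = 2].
Proof.
move=> o_odd g_in.
have [co|nco] := boolP (coprime o.+1 g.-1).
  exists o.+1; split => //; try by move: g_in; rewrite !inE; lia.
    by rewrite coprimenS.
  have -> : o + g = g.-1 + o.+1 by move: g_in; rewrite !inE; lia.
  by rewrite /coprime gcdnDr.
have [q_prime dv] : prime g.-1 /\ g.-1 %| o.+1.
  have q_prime : prime g.-1.
    by move: g_in nco; rewrite !inE => /or3P[] /eqP -> //=; rewrite coprimen1.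
  by split=> //; move: nco; rewrite coprime_sym prime_coprime // negbK.
exists (o + g.-1); split.
- by move: g_in; rewrite !inE; lia.
- by move: g_in; rewrite !inE; lia.
- rewrite /coprime gcdnDl -/(coprime _ _) coprime_sym prime_coprime //.
  apply/negP => dv'; move: dv; rewrite -addn1 dvdn_addr // dvdn1 => /eqP q1.
  by rewrite q1 in q_prime.
- have -> : o + g = (o + g.-1).+1 by move: g_in; rewrite !inE; lia.
  by rewrite coprimenS.
- by move=> o1; move: g_in q_prime dv; rewrite o1 !inE => /or3P[] /eqP ->.
Qed.

Lemma count_leS (S : seq nat) x :
  uniq S -> count (leq^~ x.+1) S = (x.+1 \in S) + count (leq^~ x) S.
Proof.
move=> S_uniq; rewrite -(count_uniq_mem _ S_uniq) -[RHS]count_predUI.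
rewrite (eq_count (a2 := leq^~ x.+1)) => [|y /=]; last by lia.
rewrite [X in _ + X](eq_count (a2 := pred0)) ?count_pred0 ?addn0 // => y /=.
by lia.
Qed.

(** What the walks require of a set of removed primes: the third condition
    bounds by 6 the gaps between the odd numbers that are kept. *)
Definition sparse_odds (S : seq nat) : Prop :=
  [/\ uniq S, {in S, forall y, odd y && (1 < y)}
    & forall y, ~~ [&& y \in S, y + 2 \in S & y + 4 \in S]].

(** The gap [g] contains [g./2.-1] odd numbers, all in [S]; the last equation
    records this as a count. The number [x] itself may or may not be in [S].
    Since 1 is not in [S], the search downwards always succeeds. *)
Lemma previous_odd (S : seq nat) x :
  sparse_odds S -> odd x -> 1 < x ->
  exists o g, [/\ g \in [:: 2; 4; 6], x = o + g, odd o, o \notin S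
    & (count (leq^~ x.-1) S).*2 + 2 = (count (leq^~ o) S).*2 + g].
Proof.
move=> [S_uniq S_odd S_gap] x_odd x1.
have odd2 z : odd z -> 1 < z -> exists2 w, z = w.+2 & odd w.
  by move=> z_odd z1; exists z.-2; lia.
have cnt w : odd w -> count (leq^~ w.+1) S = count (leq^~ w) S.
  move=> w_odd; rewrite (count_leS _ w) // [_ \in S](_ : _ = false) //.
  by apply/negP => /S_odd; rewrite /= w_odd.
have cntS w : odd w -> w.+2 \in S ->
    count (leq^~ w.+2) S = (count (leq^~ w) S).+1.
  by move=> w_odd wS; rewrite (count_leS _ w.+1) // wS cnt.
have [y xE y_odd] := odd2 _ x_odd x1; rewrite {}xE /= {x x_odd x1} cnt //.
have [yS|y_nS] := boolP (y \in S); last first.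
  by exists y, 2; split; rewrite ?addn2.
have /andP[_ y1] := S_odd _ yS.
have [z yE z_odd] := odd2 _ y_odd y1; subst y; rewrite cntS // {y1}.
have [zS|z_nS] := boolP (z \in S); last first.
  by exists z, 4; split=> //; lia.
have /andP[_ z1] := S_odd _ zS.
have [w zE w_odd] := odd2 _ z_odd z1; subst z; rewrite cntS // {z1}.
exists w, 6; split=> //; try lia.
by have := S_gap w; rewrite addn2 addn4 yS zS !andbT.
Qed.

(** The walk visits every odd number from 3 to [x] outside [S], each preceded by
    an even number, whence its length. It starts from a fictitious vertex 1.
    With default value 2, [head 2 s = 2] also covers the empty walk, for
    [x = 1]: the even number added later is then 2 as well. *)
Lemma alternating_walk (S : seq nat) x :
  sparse_odds S -> odd x -> x \notin S ->
  exists s, [/\ path coprime_lt 1 s, last 1 s = x, head 2 s = 2,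
    size s + (count (leq^~ x) S).*2 = x.-1 & {in s, forall y, y \notin S}].
Proof.
move=> S_sparse; have [S_uniq S_odd _] := S_sparse.
elim/ltn_ind: x => x IH x_odd x_nS.
have [x1|x1] := leqP x 1.
  have {x_odd x1} -> : x = 1 by case: x x_odd x1 {IH x_nS} => [|[]].
  exists [::]; split => //=.
  rewrite (_ : count _ _ = 0) //; apply/eqP; rewrite eqn0Ngt -has_count.
  by apply/hasPn => y /S_odd; rewrite -ltnNge => /andP[].
have [o [g [g_in xE o_odd o_nS cE]]] := previous_odd S x S_sparse x_odd x1.
have cx : count (leq^~ x) S = count (leq^~ x.-1) S.
  by case: x x1 x_nS {x_odd IH xE cE} => // x _ x_nS;
    rewrite (count_leS _ x) // (negbTE x_nS).
have o_x : o < x by move: g_in; rewrite !inE; lia.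
have [s [s_path s_last s_head s_size s_nS]] := IH o o_x o_odd o_nS.
have [e [/andP[oe eo] e_ev c1 c2 e2]] := even_between o g o_odd g_in.
rewrite -xE in c2 eo.
exists (s ++ [:: e; x]); split.
- by rewrite cat_path s_path s_last /= /coprime_lt oe eo c1 c2.
- by rewrite last_cat.
- by case: s s_last s_head {s_path s_size s_nS} => //= o1 _; rewrite e2.
- rewrite size_cat cx /=; move: cE s_size xE x1 o_odd; clear; lia.
- move=> y; rewrite mem_cat !inE => /or3P[/s_nS //|/eqP->|/eqP-> //].
  by apply/negP => /S_odd; rewrite (negbTE e_ev).
Qed.

(** The walk up to the last odd number o < p outside [S], closed by o + 1: with
    the leading 2, it has one even number more than odd ones. *)
Lemma initial_stretch (S : seq nat) p :
  sparse_odds S -> odd p -> 1 < p ->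
  exists l, [/\ sorted coprime (2 :: l), uniq (2 :: l),
    (size l).+1 + (count (leq^~ p.-1) S).*2 = p.-2
    & {in 2 :: l, forall y, [/\ 1 < y, y < p & y \notin S]}].
Proof.
move=> S_sparse p_odd p1; have [_ S_odd _] := S_sparse.
have [o [g [g_in pE o_odd o_nS cE]]] := previous_odd S p S_sparse p_odd p1.
have o_p : o.+1 < p by move: g_in; rewrite !inE; lia.
have [s [s_path s_last s_head s_size s_nS]] :=
  alternating_walk S o S_sparse o_odd o_nS.
have lt_tr : transitive ltn by exact: ltn_trans.
have [l lE] : exists l, rcons s o.+1 = 2 :: l.
  case: (s) s_head s_last => [_ /= <-|_ l /= ->]; first by exists [::].
  by exists (rcons l o.+1).
have l_path : path coprime_lt 1 (2 :: l).
  by rewrite -lE rcons_path s_path s_last /= /coprime_lt ltnSn coprimenS.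
have l_lt : path ltn 1 (2 :: l) by apply: sub_path l_path => x y /andP[].
exists l; split.
- have : path coprime 1 (2 :: l) by apply: sub_path l_path => x y /andP[].
  exact: path_sorted.
- by apply: (sorted_uniq lt_tr ltnn); apply: path_sorted l_lt.
- have -> : (size l).+1 = (size s).+1 by rewrite -(size_rcons s o.+1) lE.
  by move: cE s_size pE o_odd; clear; lia.
- move=> y yl; split.
  + by have /allP := order_path_min lt_tr l_lt; apply.
  + move: l_lt yl => /path_sorted; rewrite -lE (sorted_pairwise lt_tr).
    rewrite pairwise_rcons => /andP[/allP H _].
    rewrite mem_rcons inE => /predU1P[-> //|/H /=] yo.
    exact: ltn_trans yo o_p.
  + move: yl; rewrite -lE mem_rcons inE => /predU1P[->|/s_nS //].
    by apply/negP => /S_odd; rewrite /= o_odd.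
Qed.

(** * Labelings from primes in the upper half *)

(** Consecutive integers are coprime, and the last one, [a + l - 1], is odd,
    hence coprime to 2. *)
Lemma sorted_iota_cat a l (s : seq nat) :
  ~~ odd (a + l) -> sorted coprime (2 :: s) ->
  sorted coprime (iota a l ++ 2 :: s).
Proof.
move=> al_even s_cop; elim: l a al_even => [//|l IHl] a al_even.
have := IHl a.+1; rewrite addSnnS => /(_ al_even) {IHl}.
case: l al_even => [|l] al_even /= s_path; last by rewrite coprimenS.
apply/andP; split; last exact: s_cop.
by rewrite coprimen2; move: al_even; rewrite addn1 negbK.
Qed.

(** Among y, y + 2 and y + 4 one is divisible by 3, hence equal to 3 if all
    are primes, so that y = 3; but then y + 4 = 7 > 2y > k. *)
Lemma large_primes_sparse k (S : seq nat) :
  uniq S -> {in S, forall p, [/\ prime p, odd p & k < p.*2 <= k.*2]} ->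
  sparse_odds S.
Proof.
move=> S_uniq S_prime; split=> // [p /S_prime[/prime_gt1 -> ->] // | y].
apply/negP => /and3P[/S_prime[y_pr _ yk] /S_prime[y2_pr _ _]].
move=> /S_prime[y4_pr _ y4k].
have three q : prime q -> 3 %| q -> q = 3.
  by move=> q_prime; rewrite dvdn_prime2 // => /eqP.
have := three _ y_pr; have := three _ y2_pr; have := three _ y4_pr.
have := prime_gt1 y_pr; lia.
Qed.

Lemma sorted_coprime_primes (S : seq nat) :
  uniq S -> {in S, forall p, prime p} -> sorted coprime (1 :: S).
Proof.
move=> S_uniq S_prime.
rewrite /= path_min_sorted; last by apply/allP => y _; rewrite /= coprime1n.
apply: pairwise_sorted; move: S_uniq; rewrite uniq_pairwise.
apply: (@sub_in_pairwise _ (mem S)); last by apply/allP.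
move=> x y /S_prime x_pr /S_prime y_pr /= xy.
by rewrite prime_coprime // dvdn_prime2.
Qed.

(** The multiple 2p of [p] already exceeds [k]. *)
Lemma coprime_large_prime k p x :
  prime p -> k < p.*2 -> 0 < x <= k -> x != p -> coprime x p.
Proof.
move=> p_pr p_k x_itv x_p; rewrite coprime_sym prime_coprime //.
by apply/negP => /dvdnP[[|[|c]] xE]; move: xE x_itv x_p p_k; nia.
Qed.

Lemma coprime_labeling_of_primes m k (S : seq nat) :
  odd k -> uniq S -> 0 < size S -> m + (size S).*2 = k ->
  {in S, forall p, [/\ prime p, odd p & k < p.*2 <= k.*2]} ->
  has_coprime_labeling
    (join_graph (path_graph m) (path_graph (size S).+1)) k.
Proof.
move=> k_odd S_uniq S_gt0 mE S_prime.
have S_sparse := large_primes_sparse k S S_uniq S_prime.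
have [_ S_odd _] := S_sparse.
have [p pS p_max] : exists2 p, p \in S & {in S, forall q, q <= p}.
  have exP : exists p, p \in S.
    by exists (head 0 S); case: (S) S_gt0 => //= q l _; rewrite mem_head.
  have ubP q : q \in S -> q <= k by move=> /S_prime[_ _]; lia.
  by case: (ex_maxnP exP ubP) => p pS p_max; exists p.
have [p_pr p_odd p_k] := S_prime _ pS; have p1 := prime_gt1 p_pr.
have cp : size S = (count (leq^~ p.-1) S).+1.
  have <- : count (leq^~ p) S = size S.
    by apply/eqP; rewrite -all_count; apply/allP => q /p_max.
  case: p pS p1 {p_max p_pr p_odd p_k} => // p pS _.
  by rewrite (count_leS _ p) // pS.
have [l [l_cop l_uniq l_size l_mem]] := initial_stretch S p S_sparse p_odd p1.
(* As p is the largest element of S, nothing has to be removed above it. *)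
set s := iota p.+1 (k - p) ++ 2 :: l.
have le_pk : p <= k by lia.
have iota_mem y : y \in iota p.+1 (k - p) -> p < y <= k.
  by rewrite mem_iota addSn subnKC // ltnS.
have s_mem y : y \in s -> 1 < y <= k /\ y \notin S.
  rewrite mem_cat => /orP[/iota_mem/andP[py yk]|/l_mem[y1 yp y_nS]].
    rewrite yk (ltn_trans p1 py); split=> //.
    by apply/negP => /p_max; rewrite leqNgt py.
  by rewrite y1 (leq_trans (ltnW yp)).
apply: (@has_coprime_labeling_of_seq _ _ _ s (1 :: S)) => //.
- rewrite size_cat size_iota /=; move: l_size cp mE le_pk p1 p_odd.
  by clear; lia.
- have t_uniq : uniq (1 :: S).
    by rewrite cons_uniq S_uniq andbT; apply/negP => /S_odd.
  have s_uniq : uniq s.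
    rewrite cat_uniq iota_uniq l_uniq andbT; apply/hasPn => y /l_mem[_ yp _].
    by apply/negP => /iota_mem; rewrite ltnNge (ltnW yp).
  rewrite cat_uniq s_uniq t_uniq andbT; apply/hasPn => y.
  rewrite inE => yt; apply/negP => /s_mem[/andP[y1 _] /negP[]].
  by case/predU1P: yt => // y_1; rewrite y_1 in y1.
- move=> y; rewrite mem_cat => /orP[/s_mem[/andP[y1 yk] _]|].
    by rewrite yk ltnW.
  rewrite inE => /predU1P[->|yS]; first exact: leq_trans (ltnW p1) le_pk.
  have /andP[_ y1] := S_odd _ yS.
  by rewrite ltnW //=; exact: leq_trans (p_max _ yS) le_pk.
- by apply: sorted_iota_cat => //; rewrite addSn subnKC // /= k_odd.
- by apply: sorted_coprime_primes => // q /S_prime[].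
- apply/allrelP => x q /s_mem[/andP[x1 xk] x_nS].
  rewrite inE => /predU1P[->|qS]; first exact: coprimen1.
  have [q_pr _ /andP[q_k _]] := S_prime _ qS.
  apply: (coprime_large_prime k) => //; first by rewrite (ltnW x1).
  by apply: contraNneq x_nS => ->.
Qed.

(** Labelings pull back along injective graph morphisms. *)
Lemma has_coprime_labeling_sub (G H : sgraph) (h : G -> H) k :
  injective h -> (forall u v, edge u v -> edge (h u) (h v)) ->
  has_coprime_labeling H k -> has_coprime_labeling G k.
Proof.
move=> h_inj h_edge [cardH [f [f_inj f_itv f_cop]]]; split.
  exact: leq_trans (leq_card h h_inj) cardH.
exists (f \o h); split=> [|v|u v /h_edge]; first exact: inj_comp.
  exact: f_itv.
exact: f_cop.
Qed.

Lemma coprime_labeling_shorten m n k :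
  has_coprime_labeling (join_graph (path_graph m.+1) (path_graph n)) k ->
  has_coprime_labeling (join_graph (path_graph m) (path_graph n)) k.
Proof.
pose h (v : join_graph (path_graph m) (path_graph n)) :
    join_graph (path_graph m.+1) (path_graph n) :=
  match v with inl i => inl (widen_ord (leqnSn m) i) | inr j => inr j end.
apply: (has_coprime_labeling_sub _ _ h) => [[i|i] [j|j] //= [E]|[i|i] [j|j] //].
  by congr inl; apply: ord_inj.
by rewrite E.
Qed.

(** * Primes in the upper half of an interval *)

(** The interval listed is (k/2, k]. *)
Definition upper_primes k : seq nat :=
  [seq p <- iota k./2.+1 (uphalf k) | prime p].

Lemma size_upper_primes k :
  size (upper_primes k) =
    count prime (iota 0 k.+1) - count prime (iota 0 k./2.+1).
Proof.
rewrite size_filter; have -> : k.+1 = k./2.+1 + uphalf k by lia.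
by rewrite iotaD count_cat addKn.
Qed.

Lemma even_not_prime p : 2 < p -> ~~ odd p -> prime p = false.
Proof. by move=> p2; apply: contraNF => /even_prime[] // E; rewrite E in p2. Qed.

(** The interval for 2h - 1 loses 2h, which is not prime, and gains h. *)
Lemma size_upper_primes_even h :
  1 < h -> size (upper_primes h.*2) <= size (upper_primes h.*2.-1).
Proof.
move=> h1; rewrite !size_filter.
have -> : iota h.*2./2.+1 (uphalf h.*2) = iota h.+1 (h.-1 + 1).
  by congr iota; lia.
have -> : iota h.*2.-1./2.+1 (uphalf h.*2.-1) = h :: iota h.+1 h.-1.
  have -> : uphalf h.*2.-1 = h.-1.+1 by lia.
  by have -> : h.*2.-1./2.+1 = h by lia.
rewrite iotaD count_cat /= even_not_prime; lia.
Qed.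

(** From 2h + 3 to 2h + 1 the interval loses 2h + 3 and the composite number
    2h + 2, and gains h + 1. *)
Lemma size_upper_primes_odd h :
  0 < h -> size (upper_primes h.*2.+3) <= (size (upper_primes h.*2.+1)).+1.
Proof.
move=> h0; rewrite !size_filter.
have -> : iota h.*2.+3./2.+1 (uphalf h.*2.+3) = iota h.+2 (h + 2).
  by congr iota; lia.
have -> : iota h.*2.+1./2.+1 (uphalf h.*2.+1) = h.+1 :: iota h.+2 h.
  have -> : uphalf h.*2.+1 = h.+1 by lia.
  by have -> : h.*2.+1./2 = h by lia.
rewrite iotaD count_cat /= [prime (h.+2 + h)]even_not_prime; lia.
Qed.

(** Past 2, at most one of two consecutive numbers is prime. *)
Lemma count_prime_iota s l : 2 < s -> count prime (iota s l) <= uphalf l.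
Proof.
elim/ltn_ind: l s => -[//|[|l]] IH s s2; first by rewrite /= addn0 leq_b1.
have := IH l _ s.+2 (ltnW (ltnW s2)); rewrite /=.
have : prime s + prime s.+1 <= 1; last by lia.
have [so|se] := boolP (odd s); last by rewrite even_not_prime //; lia.
by rewrite (even_not_prime s.+1) //=; lia.
Qed.

(** For N >= 6, counting odd numbers in the upper half of [0, 3N - 2] suffices;
    this is too weak for smaller N, where 10 and 13 have few primes in their
    upper halves. *)
Lemma size_upper_primes_small N :
  2 < N -> exists2 k, 3 * N - 2 <= k & size (upper_primes k) < N - 1.
Proof.
move=> N2; have [N6|] := leqP 6 N.
  exists (3 * N - 2) => //; rewrite size_filter.
  apply: leq_ltn_trans (count_prime_iota _ _ _) _; lia.
case: N N2 => [|[|[|[|[|[|]]]]]] // _ _; [by exists 10 | by exists 10 |].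
by exists 13.
Qed.

(** The bound on [j] only matters for k = 3, whose upper half contains the even
    prime 2: there 3 is the only choice. *)
Lemma large_odd_primes k j :
  odd k -> j < k./2.+1 -> j <= size (upper_primes k) ->
  exists S, [/\ uniq S, size S = j
    & {in S, forall p, [/\ prime p, odd p & k < p.*2 <= k.*2]}].
Proof.
move=> k_odd jk j_le; have [k3|k3] := leqP k 3.
  have [j0|j1] : j = 0 \/ j = 1 by lia.
    by exists [::].
  have k_3 : k = 3 by lia.
  exists [:: 3]; rewrite j1 k_3; split=> // p; rewrite inE => /eqP -> //.
exists (take j (upper_primes k)); split.
- by rewrite take_uniq // filter_uniq // iota_uniq.
- exact: size_takel.
- move=> p /mem_take; rewrite mem_filter mem_iota => /andP[p_pr p_itv].
  split=> //; last by lia.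
  by apply: contraTT p_pr => p_ev; rewrite even_not_prime //; lia.
Qed.

(** * The minimum coprime number *)

Lemma coprime_labeling_upper m n :
  odd m -> 1 < n -> n.-1 <= size (upper_primes (m + 2 * n - 2)) ->
  has_coprime_labeling (join_graph (path_graph m) (path_graph n))
    (m + 2 * n - 2).
Proof.
move=> m_odd n1 n_le.
have [] := large_odd_primes (m + 2 * n - 2) n.-1 _ _ n_le; try lia.
move=> S [S_uniq S_size S_prime].
rewrite [in path_graph n](_ : n = (size S).+1); last by lia.
apply: coprime_labeling_of_primes S_uniq _ _ S_prime; rewrite ?S_size; lia.
Qed.

Lemma upper_primes_descend m n N :
  odd m -> 1 < n <= N -> N.-1 <= size (upper_primes (m + 2 * N - 2)) ->
  n.-1 <= size (upper_primes (m + 2 * n - 2)).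
Proof.
move=> m_odd /andP[n1]; elim: N => [|N IHN]; first by lia.
rewrite leq_eqVlt => /predU1P[-> //|nN] N_le; apply: IHN => //.
have := size_upper_primes_odd (m./2 + N.-1).
have <- : m + 2 * N.+1 - 2 = (m./2 + N.-1).*2.+3 by lia.
have <- : m + 2 * N - 2 = (m./2 + N.-1).*2.+1 by lia.
by move: N_le => /=; lia.
Qed.

Lemma min_coprime_numberP (G : sgraph) k :
  has_coprime_labeling G k ->
  (forall l, has_coprime_labeling G l -> k <= l) ->
  min_coprime_number G = k.
Proof.
move=> Gk k_min; rewrite /min_coprime_number.
case: ex_minnP => l /asboolP Gl l_min; apply/eqP.
by rewrite eqn_leq k_min // l_min //; apply/asboolP.
Qed.

Local Open Scope ring_scope.

(** This is the bound at the real number [a%:R], whose half truncates to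
    [a./2]. *)
Lemma ramanujan_bound_nat (R : realType) k r a :
  ramanujan_bound R k r -> r <= a%:Z -> (k <= size (upper_primes a))%N.
Proof.
move=> bound ra; have := bound a%:R; rewrite /prime_pi.
have -> : Num.truncn (a%:R / 2 : R) = a./2.
  apply: Num.Theory.truncn_def; have := odd_double_half a => aE.
  have {1 2}<- : (a./2).*2%:R + (odd a)%:R = a%:R :> R by rewrite -GRing.natrD addnC aE.
  rewrite -muln2 GRing.natrM -[a./2.+1]addn1 GRing.natrD.
  by case: odd => /=; apply/andP; split; lra.
rewrite Num.Theory.natrK size_upper_primes; apply.
by rewrite -(ler_int R) in ra.
Qed.

Theorem theorem1p3 (R : realType) (N : nat) (r M : int) :
  (2 <= N)%N ->
  is_ramanujan_prime R (N - 1)%N r ->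
  r - 2 * N%:Z + 1 <= M ->
  forall m n : nat,
    (0 < m)%N -> M <= m%:Z -> (2 <= n <= N)%N ->
    min_coprime_number (join_graph (path_graph m) (path_graph n)) =
      if odd m then (m + 2 * n - 2)%N else (m + 2 * n - 1)%N.
Proof.
move=> N2 [bound _] rM m n m0 Mm nN.
have many a : r <= a%:Z -> (N - 1 <= size (upper_primes a))%N.
  exact: ramanujan_bound_nat bound.
have n_le_m : (uphalf n <= uphalf m)%N.
  have [mN|Nm] := leqP N m; first by lia.
  have [N3|] := ltnP 2 N; last by lia.
  have [a Na] := size_upper_primes_small N N3.
  by rewrite ltnNge many //; lia.
have top : (N - 1 <= size (upper_primes (m + 2 * N - 1)))%N by apply: many; lia.
apply: min_coprime_numberP => [|k /(coprime_labeling_lower _ _ _ n_le_m)];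
  last by case: ifP; lia.
case: ifPn => m_par.
  apply: coprime_labeling_upper => //; first by lia.
  apply: (@upper_primes_descend m n N) => //.
  (* m + 2N - 1 is even here, and its odd predecessor has as many primes. *)
  have := size_upper_primes_even (m.+1./2 + N.-1).
  have <- : (m + 2 * N - 1 = (m.+1./2 + N.-1).*2)%N by lia.
  have <- : (m + 2 * N - 2 = (m + 2 * N - 1).-1)%N by lia.
  lia.
apply: coprime_labeling_shorten.
have -> : (m + 2 * n - 1 = m.+1 + 2 * n - 2)%N by lia.
apply: coprime_labeling_upper; [by lia | by lia |].
apply: (@upper_primes_descend m.+1 n N) => //.
have -> : (m.+1 + 2 * N - 2 = m + 2 * N - 1)%N by lia.
lia.
Qed.
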